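(* Let $K\ge 2$ and $\Theta=\{(\theta_1,\ldots,\theta_K):\sum_k\theta_k=1,\ \theta_k\ge0\}$. Consider Dempster's Simplex-DSM posterior for a multinomial sample of size $n=1$ with observation $X=1$: its random focal elements are $$\mathbf e(Z)=\Big\{\theta\in\Theta:\ \frac{Z_1}{\theta_1}\le\frac{Z_j}{\theta_j},\ j=2,\ldots,K\Big\},\qquad Z_1,\ldots,Z_K\stackrel{iid}{\sim}\mathrm{Expo}(1).$$ Fix $\theta_1\in(0,1)$ and consider the conditional posterior model for $\theta_{-1}\equiv(\theta_2,\ldots,\theta_K)/(1-\theta_1)$ given this value of $\theta_1$ (obtained by intersecting each focal element with $\{\theta\in\Theta:\ \text{first coordinate}=\theta_1\}$, conditioning on non-empty intersection, and mapping the result to the values of $\theta_{-1}$, which lie in the $(K-2)$-simplex $\mathcal S_{K-2}$). Then the vacuous focal element $\mathcal S_{K-2}$ receives mass $$\Pr(\mathcal S_{K-2})=\frac{1}{1+(K-2)(1-\theta_1)}\cdot\frac{1}{1+\sum_{i=1}^{K-2}(1-\theta_1)^i}.$$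
   Context: A Dempster–Shafer model (DSM) here is a random set (focal element) in the parameter space; conditioning a DSM on an event means intersecting the random set with that event and restricting to (conditioning on) non-empty intersections. The mass of $\mathcal S_{K-2}$ is the conditional probability that the resulting random set of $\theta_{-1}$-values is all of $\mathcal S_{K-2}$. *)

(* Defs.v *)
From HB Require Import structures.
From mathcomp Require Import all_boot all_order all_algebra.
From mathcomp Require Import all_classical all_reals all_analysis.
From mathcomp Require Import exponential_distribution.
Set Implicit Arguments. Unset Strict Implicit. Unset Printing Implicit Defensive.
Import Order.TTheory GRing.Theory Num.Theory.
Local Open Scope classical_set_scope.
Local Open Scope ring_scope.

Section defs.
Context {R : realType}.

Definition simplex (n : nat) : set ('I_n -> R) :=
  [set t | (forall i, 0 <= t i) /\ \sum_(i < n) t i = 1].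
Arguments simplex n : clear implicits.

(** Focal element e(z) of Dempster's Simplex-DSM posterior for n = 1, X = 1,
    with K = k+2 categories; coordinate ord0 is theta_1.
    The condition z_1/theta_1 <= z_j/theta_j is written z_1 theta_j <= z_j theta_1,
    i.e. with the convention a/0 = +oo for a > 0. *)
Definition focal (k : nat) (z : 'I_k.+2 -> R) : set ('I_k.+2 -> R) :=
  [set t | simplex k.+2 t /\
           forall j : 'I_k.+2, j != ord0 -> z ord0 * t j <= z j * t ord0].

Definition cond_focal (k : nat) (th1 : R) (z : 'I_k.+2 -> R)
  : set ('I_k.+1 -> R) :=
  [set u | exists t, focal z t /\ t ord0 = th1 /\
                     forall i : 'I_k.+1, u i = t (lift ord0 i) / (1 - th1)].

Definition mutually_independent d (T : measurableType d) (P : probability T R)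
  (n : nat) (Z : 'I_n -> {RV P >-> R}) : Prop :=
  forall B : 'I_n -> set R, (forall i, measurable (B i)) ->
    P (\bigcap_(i in [set: 'I_n]) (Z i @^-1` B i)) =
    (\prod_(i < n) P (Z i @^-1` B i))%E.

Definition iid_expo1 d (T : measurableType d) (P : probability T R)
  (n : nat) (Z : 'I_n -> {RV P >-> R}) : Prop :=
  mutually_independent Z /\
  forall i B, measurable B -> distribution P (Z i) B = exponential_prob 1 B.

Definition cond_prob d (T : measurableType d) (P : probability T R)
  (A B : set T) : R := fine (P (A `&` B)) / fine (P B).

End defs.
Arguments simplex {R} n.

(* Main.v *)
(** Almost surely all coordinates are positive.  With [q = 1 - th1], the focal
    element cut at [th1] is then the whole simplex iff
    [(q / th1) Z_1 <= min_(j > 1) Z_j], since it suffices to test the vertices,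
    and it is non-empty iff [(q / th1) Z_1 <= \sum_(j > 1) Z_j].

    Both probabilities come from one exponential race: if, on an event [F], [Y]
    has tail [a e^(- l y)] for [y >= 0] and is independent of an Exp(1) variable
    [X], then [P (Y > r + c X, F) = a e^(- l r) / (1 + l c)].  The minimum of the
    [K - 1] last coordinates is Exp(K - 1), so racing it against [(q / th1) Z_1]
    gives [th1 / (1 + (K - 2) q)].  By lack of memory [Z_1] beats
    [(th1 / q) Z_2], ..., [(th1 / q) Z_K] one after the other, each with
    probability [q], so the empty intersection has probability [q ^ (K - 1)],
    and [1 - q ^ (K - 1) = th1 (1 + q + ... + q ^ (K - 2))]. *)
Require Import Defs.
From HB Require Import structures.
From mathcomp Require Import all_boot all_order all_algebra.
From mathcomp Require Import all_classical all_reals all_analysis.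
From mathcomp Require Import measurable_realfun exponential_distribution.
From mathcomp Require Import ring lra.
Import Order.TTheory GRing.Theory Num.Theory.
Import numFieldTopology.Exports.
Local Open Scope classical_set_scope.
Local Open Scope ring_scope.

(** * Tail, change of density and Laplace transform of exponential laws *)

(* The library's instance takes the positivity proof as an argument, which
   unification cannot guess. *)
Definition expo_law (R : realType) (l : R) (l0 : 0 < l) :
  probability (measurableTypeR R) R :=
  exponential_distribution_exponential_prob__canonical__probability_measure_Probability l0.
Arguments expo_law {R l} l0.

(** Lebesgue measure does not charge the endpoint, so [b] may be taken closed; the fundamental
    theorem of calculus then applies to the antiderivative [- expR (- l * x)]. *)
Lemma expo_tail (R : realType) (l : R) (b : bool) (y : R) : 0 < l -> 0 <= y ->
  exponential_prob l [set` Interval (BSide b y) +oo%O] = (expR (- l * y))%:E.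
Proof.
move=> l0 y0.
have -> : exponential_prob l [set` Interval (BSide b y) +oo%O] =
          exponential_prob l `[y, +oo[%classic.
  case: b => //; apply: integral_itv_obnd_cbnd.
  by apply/measurable_EFinP/measurable_funTS; exact: measurable_exponential_pdf.
have cexp : continuous (fun z : R^o => expR (- l * z)).
  move=> z; apply: continuous_comp; last exact: continuous_expR.
  by apply: continuousM => //; apply: (@continuousN _ R^o); exact: cst_continuous.
have sub : `[y, +oo[%classic `<=` (`[0, +oo[%classic : set R).
  by apply: subset_itvr; rewrite bnd_simp.
rewrite /exponential_prob (@ge0_continuous_FTC2y _ _
  (fun x => - (expR (- l * x))) _ 0)//.
- by rewrite EFinN oppeK add0e.
- by move=> x _; apply: exponential_pdf_ge0; exact: ltW.
- by apply: continuous_subspaceW; [exact: sub|exact: within_continuous_exponential_pdf].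
- rewrite -oppr0; apply: cvgN.
  rewrite (_ : (fun x => expR (- l * x)) =
               (fun z => expR (- z)) \o (fun z => l * z)); last first.
    by apply: eq_fun => x; rewrite mulNr.
  apply: (@cvg_comp _ _ _ _ _ _ (pinfty_nbhs R)); last exact: cvgr_expR.
  exact: gt0_cvgMry.
- by apply: cvgN; apply/cvg_at_right_filter; exact: cexp.
- move=> x; rewrite in_itv/= andbT => yx.
  by apply: derive1_exponential_pdf; rewrite in_itv/= andbT (le_lt_trans y0).
Qed.

(** Change of variables holds with the Radon-Nikodym derivative, which agrees almost everywhere with
    [exponential_pdf l] because both have the same integral over every measurable set. *)
Lemma integral_expo_law (R : realType) (l : R) (l0 : 0 < l) (E : set R) (f : R -> \bar R) :
  measurable E -> (expo_law l0).-integrable E f ->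
  (\int[expo_law l0]_(x in E) f x =
   \int[lebesgue_measure]_(x in E) (f x * (exponential_pdf l x)%:E))%E.
Proof.
move=> mE intf.
have mpdf D : measurable_fun D (EFin \o exponential_pdf l).
  by apply/measurable_EFinP/measurable_funTS; exact: measurable_exponential_pdf.
have dom : expo_law l0 `<< @lebesgue_measure R.
  apply/null_content_dominatesP => A mA A0.
  exact: (null_set_integral mA (mpdf A) A0).
rewrite -(Radon_Nikodym_change_of_variables dom mE intf).
have intg : lebesgue_measure.-integrable setT
    (Radon_Nikodym (charge_of_finite_measure (expo_law l0)) lebesgue_measure).
  exact: Radon_Nikodym_integrable.
have mf := measurable_int _ intf.
apply: ae_eq_integral => //.
- apply: emeasurable_funM => //.
  by apply: measurable_funTS; exact: (measurable_int _ intg).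
- exact: (emeasurable_funM mf (mpdf E)).
- apply: ae_eqe_mul2l; apply: integral_ae_eq => [//| | |A _ mA].
  + apply: integrableS intg => //; exact: measurableT.
  + exact: mpdf.
  + by have := @Radon_Nikodym_integral _ _ _
      (charge_of_finite_measure (expo_law l0)) _ A dom mA => <-.
Qed.

(** Exponential tilting: [expR (- s * x)] times the density of rate [l] is [l / (l + s)] times the
    density of rate [l + s], which has mass 1 on the half-line. *)
Lemma expo_laplace (R : realType) (l : R) (l0 : 0 < l) (s : R) : 0 <= s ->
  (\int[expo_law l0]_(x in `]0%R, +oo[) (expR (- s * x))%:E = (l / (l + s))%:E)%E.
Proof.
move=> s0; have ls0 : 0 < l + s by rewrite ltr_wpDr.
have me : measurable_fun (`]0, +oo[%classic : set R) (fun x : R => (expR (- s * x))%:E).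
  apply/measurable_EFinP/measurable_funTS/measurableT_comp => //.
rewrite integral_expo_law//; last first.
  apply: (@le_integrable _ _ _ (expo_law l0) _ _ _ (cst 1%E)) => //.
  - move=> x /=; rewrite in_itv/= andbT => x0.
    rewrite lee_fin ger0_norm ?expR_ge0// normr1 -expR0 ler_expR.
    by rewrite mulNr oppr_le0 mulr_ge0// ltW.
  - by apply: (integrableS measurableT) => //; exact: finite_measure_integrable_cst.
transitivity (\int[lebesgue_measure]_(x in `]0%R, +oo[)
   ((l / (l + s))%:E * (exponential_pdf (l + s) x)%:E))%E.
  apply: eq_integral => x; rewrite inE/= in_itv/= andbT => x0.
  rewrite -!EFinM !exponential_pdfE ?ltW//; congr EFin.
  have -> : - (l + s) * x = - s * x + - l * x by ring.
  by rewrite expRD; field; rewrite gt_eqF.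
rewrite ge0_integralZl_EFin//=; last 3 first.
- by move=> x _; rewrite lee_fin exponential_pdf_ge0// ltW.
- by apply/measurable_EFinP/measurable_funTS; exact: measurable_exponential_pdf.
- by rewrite divr_ge0 ?ltW.
rewrite -[X in (_ * X)%E]/(exponential_prob (l + s) `]0, +oo[%classic).
by rewrite expo_tail// mulr0 expR0 mule1.
Qed.

(** * Comparison of measures and measurability of events *)

Lemma measure_eq_off_null d (T : measurableType d) (R : realType)
    (mu : {measure set T -> \bar R}) (N A B : set T) :
  measurable N -> measurable A -> measurable B -> mu N = 0%E ->
  (forall w, ~ N w -> A w <-> B w) -> mu A = mu B.
Proof.
move=> mN; have le_off (C D : set T) : measurable C -> measurable D -> mu N = 0%E ->
    (forall w, ~ N w -> C w -> D w) -> (mu C <= mu D)%E.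
  move=> mC mD N0 CD; apply: (@le_trans _ _ (mu (D `|` N))).
    apply: le_measure; rewrite ?inE//; first exact: measurableU.
    by move=> w Cw; have [Nw|Nw] := pselect (N w); [right|left; exact: CD].
  by have := measureU2 mu mD mN; rewrite [X in (_ <= _ + X)%E]N0 adde0.
move=> mA mB N0 AB; apply/eqP; rewrite eq_le.
by apply/andP; split; apply: le_off => // w Nw; apply AB.
Qed.

(** Open upper rays are stable under intersection, generate the Borel sets, and the rays from
    [- n%:R] exhaust the line. *)
Lemma finite_measure_eq_rays (R : realType)
    (m1 m2 : {measure set (measurableTypeR R) -> \bar R}) :
  (m1 setT < +oo)%E ->
  (forall y : R, m1 `]y, +oo[%classic = m2 `]y, +oo[%classic) ->
  forall A, measurable A -> m1 A = m2 A.
Proof.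
move=> m1oo m12 A mA.
refine (@measure_unique _ R (measurableTypeR R) (@RGenOInfty.G R) (fun n => `]- n%:R, +oo[%classic)
  _ _ _ _ m1 m2 _ _ A mA).
- exact: RGenOInfty.measurableE.
- move=> _ _ [x ->] [y ->]; exists (Num.max x y).
  by apply/seteqP; split => z /=; rewrite !in_itv/= !andbT gt_max => /andP.
- by move=> n; exists (- n%:R).
- rewrite -subTset => x _; exists (Num.bound `|x|) => //=.
  rewrite in_itv/= andbT ltrNl.
  rewrite (le_lt_trans (ler_norm _))// normrN.
  exact: (@archi_boundP R _ (normr_ge0 x)).
- by move=> _ [x ->].
- move=> n; apply: le_lt_trans m1oo; apply: le_measure; rewrite ?inE//.
Qed.

Definition image_measure d d' (T : measurableType d) (U : measurableType d')
    (R : realType) (mu : {measure set T -> \bar R}) (f : T -> U)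
    (mf : measurable_fun setT f) : {measure set U -> \bar R} :=
  measure_function_pushforward__canonical__measure_function_Measure mu mf.
Arguments image_measure {d d' T U R} mu {f} mf.

Lemma measurable_forall d (T : measurableType d) (I : finType) (D : pred I) (E : I -> set T) :
  (forall i, D i -> measurable (E i)) ->
  measurable [set w | forall i, D i -> E i w].
Proof.
move=> mE.
rewrite (_ : [set _ | _] = \bigcap_(i in [set i | D i]) E i); last first.
  by apply/seteqP; split => [w Ew i /=|w Ew i Di]; exact: Ew.
by apply: fin_bigcap_measurable => //; exact: finite_finset.
Qed.

Lemma measurable_ler_set d (T : measurableType d) (R : realType) (f g : T -> R) :
  measurable_fun setT f -> measurable_fun setT g ->
  measurable [set w | f w <= g w].
Proof.
move=> mf mg; rewrite (_ : [set _ | _] = (fun w => f w <= g w) @^-1` [set true]).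
  by rewrite -[X in measurable X]setTI; exact: measurable_fun_ler.
by apply/seteqP; split => w /=.
Qed.

Lemma measurable_fun_bigmin d (T : measurableType d) (R : realType) (I : Type)
    (s : seq I) (f0 : T -> R) (f : I -> T -> R) :
  measurable_fun setT f0 -> (forall i, measurable_fun setT (f i)) ->
  measurable_fun setT (fun w => \big[Num.min/f0 w]_(i <- s) f i w).
Proof.
move=> mf0 mf; elim: s => [|i s IH].
  by under eq_fun do rewrite big_nil.
by under eq_fun do rewrite big_cons; exact: measurable_minr.
Qed.

(** Below 0 the ray already carries the full mass; this form covers every ray, as
    [finite_measure_eq_rays] requires. *)
Lemma expo_ray (R : realType) (l y : R) : 0 < l ->
  exponential_prob l `]y, +oo[%classic = (expR (- l * Num.max y 0))%:E.
Proof.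
move=> l0; have [y0|y0] := leP 0 y; first by rewrite expo_tail.
rewrite mulr0 expR0.
apply/eqP; rewrite eq_le (probability_le1 (expo_law l0))//=.
rewrite -[leLHS](_ : exponential_prob l `]0, +oo[%classic = _); last first.
  by rewrite expo_tail// mulr0 expR0.
apply: (le_measure (expo_law l0)); rewrite ?inE//; try exact: measurable_itv.
by apply: subset_itvr; rewrite bnd_simp ltW.
Qed.

(** * The exponential race *)

Section race.
Context d (T : measurableType d) (R : realType) (P : probability T R).
Variables (X Y : T -> R) (F : set T) (a l : R).
Hypotheses (mX : measurable_fun setT X) (mY : measurable_fun setT Y).
Hypotheses (mF : measurable F) (l0 : 0 < l).
Hypothesis XYF : forall (y : R) (A : set R), 0 <= y -> measurable A ->
  P (Y @^-1` `]y, +oo[ `&` (X @^-1` A `&` F)) =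
  ((a * expR (- l * y))%:E * exponential_prob 1 A)%E.

Let mpreX A : measurable A -> measurable (X @^-1` A).
Proof. by rewrite -[X in _ -> measurable X]setTI; exact: mX. Qed.

Let mpreY A : measurable A -> measurable (Y @^-1` A).
Proof. by rewrite -[X in _ -> measurable X]setTI; exact: mY. Qed.

(** With [y = 0] and [A = setT], the hypothesis exhibits [a] as the probability of [Y > 0] on [F];
    the sign lets [a] scale a measure. *)
Lemma race_const_ge0 : 0 <= a.
Proof.
rewrite -lee_fin; have := XYF 0 setT (lexx 0) measurableT.
rewrite [exponential_prob 1 _](@probability_setT _ _ _ (expo_law ltr01)).
by rewrite mule1 mulr0 expR0 mulr1 => <-.
Qed.

(** [XYF] describes [Y] only above levels [y >= 0], so the joint law of [X] and [Y] is restricted to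
    this event. *)
Let posY : set T := Y @^-1` `]0, +oo[ `&` F.

Let mposY : measurable posY.
Proof. by apply: measurableI => //; exact: mpreY. Qed.

(* [R] and [measurableTypeR R] have the same measurable sets but different
   displays; the exponential laws live on the latter. *)
Let rX : T -> measurableTypeR R := X.
Let rY : T -> measurableTypeR R := Y.

Let mrX : measurable_fun setT rX. Proof. exact: mX. Qed.

Let mrY : measurable_fun setT rY. Proof. exact: mY. Qed.

Let mXY : measurable_fun setT (fun w => (rX w, rY w)).
Proof. exact: measurable_fun_pair. Qed.

Let law := image_measure (mrestr P mposY) mXY.

Let lawX := mscale (NngNum race_const_ge0) (expo_law (@ltr01 R)).

(** For fixed [A] both sides are finite measures in [B], and [XYF] makes them agree on rays. This
    product formula is what permits Fubini in the race. *)
Lemma race_rectangle (A B : set (measurableTypeR R)) : measurable A -> measurable B ->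
  law (A `*` B) = (lawX A * expo_law l0 B)%E.
Proof.
move=> mA.
have mXAF : measurable (X @^-1` A `&` posY).
  by apply: measurableI => //; exact: mpreX.
have E1 : exponential_prob 1 A = (fine (exponential_prob 1 A))%:E.
  by rewrite fineK// (fin_num_measure (expo_law (@ltr01 R))).
have c0 : 0 <= a * fine (exponential_prob 1 A).
  by rewrite mulr_ge0 ?race_const_ge0// fine_ge0// (measure_ge0 (expo_law (@ltr01 R))).
pose m1 := image_measure (mrestr P mXAF) mrY.
pose m2 := mscale (NngNum c0) (expo_law l0).
have m12 B' : measurable B' -> m1 B' = m2 B'.
  apply: finite_measure_eq_rays.
    rewrite (@le_lt_trans _ _ 1%E) ?ltry//.
    by apply: probability_le1; rewrite preimage_setT setTI.
  (* Since [posY] forces [Y > 0], a ray starting below 0 may be cut at 0, where [XYF] applies. *)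
  move=> y; have -> : m1 `]y, +oo[%classic = m1 `]Num.max y 0, +oo[%classic.
    rewrite /m1 /image_measure/= /pushforward /mrestr; congr (P _).
    apply/seteqP; split => w; rewrite /posY/= !in_itv/= !andbT gt_max.
      by move=> [yw [Aw [Yw Fw]]]; rewrite yw Yw.
    by move=> [/andP[yw _] []].
  transitivity ((a * fine (exponential_prob 1 A))%:E *
      (expR (- l * Num.max y 0))%:E)%E; last first.
    by congr (_ * _)%E; exact/esym/expo_ray.
  have y0 : 0 <= Num.max y 0 by rewrite le_max lexx orbT.
  transitivity (P (Y @^-1` `](Num.max y 0), +oo[ `&` (X @^-1` A `&` F))).
    rewrite /m1 /image_measure/= /pushforward /mrestr; congr (P _).
    apply/seteqP; split => w; rewrite /posY/= !in_itv/= !andbT gt_max.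
      by move=> [yw [Aw [_ Fw]]].
    by move=> [/[dup] /andP[_ Yw] yw [Aw Fw]].
  by rewrite XYF// E1 -!EFinM mulrAC.
move=> mB.
transitivity (m1 B).
  rewrite /m1 /law /image_measure/= /pushforward /mrestr; congr (P _).
  by apply/seteqP; split => w /=; tauto.
by rewrite m12// /m2 /lawX /mscale/= E1 EFinM.
Qed.

(** Given [X = x > 0], the tail of [Y] beyond [r + c * x] contributes
    [expR (- l * r) * expR (- (l * c) * x)]; integrating over [x] is a Laplace transform at [l * c].
    The flag [b] covers strict and large inequalities. *)
Lemma exponential_race (c r : R) (b : bool) : 0 < c -> 0 <= r ->
  P (X @^-1` `]-oo, 0]) = 0%E ->
  P ([set w | Y w \in Interval (BSide b (r + c * X w)) +oo%O] `&` F) =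
  (a * expR (- l * r) / (1 + l * c))%:E.
Proof.
move=> c0 r0 X0.
(* Requiring a positive first coordinate costs only a null event and keeps the threshold [r + c * x]
   positive, so that being in [posY] is automatic. *)
pose C : set (measurableTypeR R * measurableTypeR R) :=
  [set xy | 0 < xy.1 /\ xy.2 \in Interval (BSide b (r + c * xy.1)) +oo%O].
have mC : measurable C.
  pose g : measurableTypeR R * measurableTypeR R -> R := fun xy => xy.2 - c * xy.1.
  have mg : measurable_fun setT g.
    apply: measurable_funB; first exact: measurable_snd.
    by apply: measurable_funM => //; exact: measurable_fst.
  have mf : measurable_fun setT
      (fst : measurableTypeR R * measurableTypeR R -> R) by exact: measurable_fst.
  have -> : C = fst @^-1` `]0, +oo[%classic `&`
                g @^-1` [set` Interval (BSide b r) +oo%O].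
    by apply/seteqP; split => -[x y]; rewrite /C /g /= !in_itv/= !andbT lteifBrDr.
  apply: measurableI; first by rewrite -[X in measurable X]setTI; exact: mf.
  by rewrite -[X in measurable X]setTI; apply: mg => //; exact: measurable_itv.
transitivity (law C).
  apply: (@measure_eq_off_null _ _ _ _ (X @^-1` `]-oo, 0]%classic)) => //.
  - exact: mpreX.
  - apply: measurableI => //.
    have mh : measurable_fun setT (fun w => Y w - c * X w).
      by apply: measurable_funB => //; exact: measurable_funM.
    rewrite (_ : [set _ | _] =
      (fun w => Y w - c * X w) @^-1` [set` Interval (BSide b r) +oo%O]); last first.
      by apply/seteqP; split => w; rewrite /= !in_itv/= !andbT lteifBrDr.
    by rewrite -[X in measurable X]setTI; apply: mh => //; exact: measurable_itv.
  - apply: measurableI => //; rewrite -[X in measurable X]setTI.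
    exact: mXY.
  - move=> w /=; rewrite in_itv/= => /negP; rewrite -ltNge => Xw.
    rewrite /C /posY/= !in_itv/= !andbT; split.
      move=> [Yw Fw]; split => //; split => //.
      apply: lt_le_trans (lteifW Yw).
      by rewrite ltr_wpDl// mulr_gt0.
    by move=> [[_ Yw] [_ Fw]].
have secE x : expo_law l0 (xsection C x) =
    ((fun x => ((expR (- l * r))%:E * (expR (- (l * c) * x))%:E)%E)
       \_ `]0, +oo[) x.
  rewrite patchE; case: ifPn => [|].
    rewrite inE/= in_itv/= andbT => x0.
    have -> : xsection C x = [set` Interval (BSide b (r + c * x)) +oo%O].
      by apply/seteqP; split => y; rewrite /xsection/= inE/C/=; tauto.
    rewrite [LHS]expo_tail ?addr_ge0 ?mulr_ge0 ?(ltW c0) ?(ltW x0)//.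
    by rewrite -EFinM -expRD; congr (expR _)%:E; ring.
  rewrite notin_setE/= in_itv/= andbT => x0.
  rewrite (_ : xsection C x = set0) ?measure0//.
  by apply/seteqP; split => y; rewrite /xsection/= inE/C/= => -[].
have msec := measurable_fun_xsection (expo_law l0) mC.
(* The formula on rectangles identifies [law] with a product measure, whose value on [C] is the
   integral of its sections. *)
rewrite -(product_measure_unique race_rectangle mC).
transitivity (a%:E * \int[expo_law ltr01]_x (expo_law l0 (xsection C x)))%E.
  exact: (ge0_integral_mscale _ measurableT _ msec).
under eq_integral do rewrite secE.
rewrite -integral_mkcond ge0_integralZl_EFin//=; last first.
  by apply/measurable_EFinP/measurable_funTS/measurableT_comp.
rewrite expo_laplace ?mulr_ge0 ?(ltW l0) ?(ltW c0)// -!EFinM; congr EFin.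
by rewrite mulrA mul1r.
Qed.
End race.

(** * Pointwise description of the conditioned focal elements *)

Section cond_focal_sets.
Context (R : realType) (k : nat) (t : R) (z : 'I_k.+2 -> R).
Hypothesis t01 : 0 < t < 1.

Let t0 : 0 < t. Proof. by case/andP: t01. Qed.
Let q0 : 0 < 1 - t. Proof. by rewrite subr_gt0; case/andP: t01. Qed.

(** The only point of the slice above [u] is [(t, (1 - t) u)], so the constraints become linear in
    [u]. *)
Lemma cond_focalE (u : 'I_k.+1 -> R) : cond_focal t z u <->
  simplex k.+1 u /\ forall j, z ord0 * (1 - t) * u j <= t * z (lift ord0 j).
Proof.
split=> [[th [[[th0 th1] zth]]] [tht uE]|[[u0 u1] zu]].
  have thE j : th (lift ord0 j) = (1 - t) * u j.
    by rewrite uE mulrC divfK// gt_eqF.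
  split; first split.
  - by move=> i; rewrite uE divr_ge0// ltW.
  - under eq_bigr do rewrite uE.
    move: th1; rewrite big_ord_recl tht -mulr_suml => /eqP.
    by rewrite addrC eq_sym -subr_eq => /eqP <-; rewrite divff// gt_eqF.
  - move=> j; rewrite -mulrA -thE [leRHS]mulrC -tht.
    by apply: zth; rewrite -(inj_eq val_inj).
pose th (i : 'I_k.+2) := if unlift ord0 i is Some j then (1 - t) * u j else t.
have thl j : th (lift ord0 j) = (1 - t) * u j by rewrite /th liftK.
have th0 : th ord0 = t by rewrite /th unlift_none.
exists th; split; last first.
  by split=> // i; rewrite thl mulrC mulKf// gt_eqF.
split; first split.
- by move=> i; rewrite /th; case: unlift => [j|]; rewrite ?mulr_ge0// ltW.
- rewrite big_ord_recl th0; under eq_bigr do rewrite thl.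
  by rewrite -mulr_sumr u1 mulr1 addrC subrK.
- move=> j; case: (unliftP ord0 j) => [i ->|->]; last by rewrite eqxx.
  by move=> _; rewrite thl th0 mulrA [leRHS]mulrC.
Qed.

Lemma simplex_vertex (n : nat) (i : 'I_n) :
  simplex n (fun j => (j == i)%:R : R).
Proof.
split=> [j|]; first exact: ler0n.
by rewrite (bigD1 i)//= eqxx big1 ?addr0// => j /negbTE ->.
Qed.

(** Linear constraints hold on the simplex as soon as they hold at its vertices. For [j != i] they
    only ask [z (lift ord0 j)] to be nonnegative. *)
Lemma cond_focal_fullE : cond_focal t z = simplex k.+1 <->
  forall i j, z ord0 * (1 - t) * (j == i)%:R <= t * z (lift ord0 j).
Proof.
split=> [full i j|vert].
  suff /cond_focalE[_ /(_ j)//] : cond_focal t z (fun j => (j == i)%:R).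
  by rewrite full; exact: simplex_vertex.
apply/seteqP; split=> u; first by case/cond_focalE.
move=> u_simplex; apply/cond_focalE; split => // j; case: u_simplex => u0 u1.
rewrite -[leRHS]mulr1 -[X in _ <= _ * X]u1 mulr_sumr.
(* Average the vertex inequalities for coordinate [j] with weights [u i]; only the vertex [i = j]
   contributes on the left. *)
apply: le_trans (ler_sum _ (fun i _ => ler_wpM2r (u0 i) (vert i j))).
rewrite (bigD1 j)//= eqxx mulr1 big1 ?addr0// => i ij.
by rewrite eq_sym (negbTE ij) mulr0 mul0r.
Qed.

(* A probability is unconstrained on non-measurable sets, so the event has to be
   described exactly, including the null case [z ord0 <= 0]. *)
Lemma cond_focal_neq0E : cond_focal t z !=set0 <->
  if 0 < z ord0 then
    (forall j, 0 <= t * z (lift ord0 j)) /\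
    z ord0 * (1 - t) <= t * \sum_j z (lift ord0 j)
  else \sum_j Num.max (- (t * z (lift ord0 j))) 0 <= - (z ord0 * (1 - t)).
Proof.
case: ltP => [z0|z0]; split.
- move=> [u /cond_focalE[[u0 u1] zu]]; split.
    by move=> j; apply: le_trans (zu j); rewrite !mulr_ge0// ltW.
  rewrite -[leLHS]mulr1 -[X in _ * X <= _]u1 mulr_sumr mulr_sumr.
  exact: ler_sum.
- move=> [zj]; set S := \sum_j _ => zS.
  have S0 : 0 < S.
    by rewrite -(pmulr_rgt0 _ t0) (lt_le_trans _ zS)// mulr_gt0.
  (* Sharing the unit mass in proportion to the upper bounds meets all of them as soon as their
     total suffices. *)
  exists (fun j => z (lift ord0 j) / S); apply/cond_focalE; split; first split.
  + by move=> j; rewrite divr_ge0// ?(ltW S0)// -(pmulr_rge0 _ t0).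
  + by rewrite -mulr_suml divff// gt_eqF.
  + move=> j; rewrite mulrA ler_pdivrMr// [leRHS]mulrAC.
    by rewrite ler_wpM2r// -(pmulr_rge0 _ t0).
- move=> [u /cond_focalE[[u0 u1] zu]].
  rewrite -[leRHS]mulr1 -[X in _ <= _ * X]u1 mulr_sumr; apply: ler_sum => j _.
  rewrite ge_max mulNr lerN2 zu/= oppr_ge0.
  by rewrite mulr_le0_ge0// mulr_le0_ge0// ltW.
(* For [z ord0 <= 0] the constraints are lower bounds [- (t * z (lift ord0 j)) <= p * u j]; as
   [p * u j >= 0], only the negative parts [m j] matter. *)
- set m := fun j => Num.max (- (t * z (lift ord0 j))) 0.
  set p := - (z ord0 * (1 - t)) => mp.
  have {}mp : \sum_j m j <= p by [].
  have p0 : 0 <= p by rewrite oppr_ge0 mulr_le0_ge0// ltW.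
  have m0 j : 0 <= m j by rewrite le_max lexx orbT.
  have mz j : - m j <= t * z (lift ord0 j).
    by rewrite lerNl le_max lexx.
  suff [u [us um]] : exists u, simplex k.+1 u /\ forall j, m j <= p * u j.
    exists u; apply/cond_focalE; split => // j; apply: le_trans (mz j).
    by rewrite lerNr -mulNr um.
  have [p00|pn0] := eqVneq p 0.
    exists (fun j => (j == ord0)%:R); split; first exact: simplex_vertex.
    move=> j; rewrite p00 mul0r -p00; apply: le_trans mp.
    by rewrite (bigD1 j)//= -[leLHS]addr0 lerD2l sumr_ge0.
  have pgt0 : 0 < p by rewrite lt_neqAle eq_sym pn0.
  (* The slack left by the lower bounds is spread evenly over the [k.+1] coordinates, so that they
     sum to 1. *)
  pose e := (p - \sum_j m j) / k.+1%:R.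
  have e0 : 0 <= e by rewrite divr_ge0// subr_ge0.
  exists (fun j => (m j + e) / p); split; first split.
  + by move=> j; rewrite divr_ge0// addr_ge0.
  + rewrite -mulr_suml big_split/= sumr_const card_ord -[e *+ _]mulr_natr.
    by rewrite /e divfK ?pnatr_eq0// addrC subrK divff.
  + by move=> j; rewrite mulrC divfK// lerDl.
Qed.

End cond_focal_sets.

(** * Independent Exp(1) coordinates and their almost sure positivity *)

Section iid_exponential.
Context d (T : measurableType d) (R : realType) (P : probability T R) (n : nat).
Variable Z : 'I_n.+1 -> {RV P >-> R}.
Hypothesis iidZ : iid_expo1 Z.

Lemma iid_expo1_bigcap (B : 'I_n.+1 -> set R) : (forall i, measurable (B i)) ->
  P [set w | forall i, B i (Z i w)] =
  (\prod_i fine (exponential_prob 1 (B i)))%:E.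
Proof.
move=> mB; have [indep law] := iidZ.
rewrite (_ : [set _ | _] = \bigcap_(i in [set: 'I_n.+1]) (Z i @^-1` B i)); last first.
  by apply/seteqP; split => [w Bw i _|w Bw i]; exact: Bw.
rewrite indep// -prodEFin; apply: eq_bigr => i _.
rewrite -[LHS]/(distribution P (Z i) (B i)) law// fineK//.
exact: (fin_num_measure (expo_law (@ltr01 R)) _ (mB i)).
Qed.

Let N : set T := ~` [set w | forall i, 0 < Z i w].

Let measurable_Z i (A : set R) : measurable A -> measurable (Z i @^-1` A).
Proof. by move=> mA; exact: measurable_funPTI. Qed.

Let measurable_allpos : measurable [set w | forall i, 0 < Z i w].
Proof.
rewrite (_ : [set _ | _] =
    [set w | forall i, xpredT i -> (Z i @^-1` `]0, +oo[) w]); last first.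
  apply/seteqP; split => w Zw i => [_|]; first by rewrite /= in_itv/= andbT.
  by have := Zw i isT; rewrite /= in_itv/= andbT.
by apply: measurable_forall => i _; exact: measurable_Z.
Qed.

Lemma iid_expo1_allpos : P N = 0%E.
Proof.
rewrite probability_setC// [X in (_ - X)%E](_ : _ = 1%E) ?subee//.
rewrite (_ : [set _ | _] = [set w | forall i, `]0, +oo[%classic (Z i w)]).
  rewrite (iid_expo1_bigcap (fun=> `]0, +oo[%classic)); last first.
    by move=> i; exact: measurable_itv.
  by rewrite big1// => i _; rewrite expo_tail// mulr0 expR0.
by apply/seteqP; split => w Zw i; have := Zw i; rewrite /= in_itv/= andbT.
Qed.

(** Reduces the comparison of events to sample points with positive coordinates, discarding the
    degenerate sign cases. *)
Lemma iid_expo1_eq (A B : set T) : measurable A -> measurable B ->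
  (forall w, (forall i, 0 < Z i w) -> A w <-> B w) -> P A = P B.
Proof.
move=> mA mB AB; apply: (@measure_eq_off_null _ _ _ _ N) => //.
- exact: measurableC.
- exact: iid_expo1_allpos.
- by move=> w Nw; apply: AB; exact: contrapT.
Qed.

Lemma iid_expo1_npos i : P (Z i @^-1` `]-oo, 0]) = 0%E.
Proof.
rewrite -(measure0 P); apply: iid_expo1_eq => //; first exact: measurable_Z.
by move=> w /(_ i) Zi; split => //=; rewrite in_itv/= leNgt Zi.
Qed.

End iid_exponential.
Arguments iid_expo1_bigcap {d T R P n Z} iidZ B.
Arguments iid_expo1_npos {d T R P n Z} iidZ i.
Arguments iid_expo1_eq {d T R P n Z} iidZ A B.

(** * Races of the first coordinate against the sum and the minimum of the others *)

Section races.
Context d (T : measurableType d) (R : realType) (P : probability T R) (n : nat).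
Variable Z : 'I_n.+1 -> {RV P >-> R}.
Hypothesis iidZ : iid_expo1 Z.
Let Z' (i : 'I_n) : {RV P >-> R} := Z (lift ord0 i).

(* The coordinates still to come stay in arbitrary Borel sets [B i]: this is the
   independence that the next step of the induction feeds to
   [exponential_race]. *)
Lemma sum_race_partial (c : R) (m : nat) (y : R) (B : 'I_n -> set R) :
  0 < c -> 0 <= y -> (m <= n)%N -> (forall i, measurable (B i)) ->
  P ([set w | y < Z ord0 w - c * \sum_(i < n | (i < m)%N) Z' i w] `&`
     [set w | forall i : 'I_n, (m <= i)%N -> B i (Z' i w)]) =
  ((1 + c)^-1 ^+ m * expR (- y) *
   \prod_(i < n | (m <= i)%N) fine (exponential_prob 1 (B i)))%:E.
Proof.
move=> c0; elim: m y B => [|m IH] y B y0 mn mB.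
  rewrite expr0 mul1r.
  (* With nothing subtracted yet, the event is a product: a ray for the first coordinate and [B] for
     the others. *)
  pose B0 i := if unlift ord0 i is Some j then B j else `]y, +oo[%classic.
  rewrite (_ : _ `&` _ = [set w | forall i, B0 i (Z i w)]); last first.
    have s0 w : \sum_(i < n | (i < 0)%N) Z' i w = 0 by rewrite big1.
    apply/seteqP; split => [w /= [yw Bw] i|w /= Bw].
      rewrite /B0; case: unliftP => [j ->|->]; first exact: Bw.
      by rewrite /= in_itv/= andbT; move: yw; rewrite s0 mulr0 subr0.
    split => [|i _].
      have := Bw ord0; rewrite /B0 unlift_none/= in_itv/= andbT.
      by rewrite s0 mulr0 subr0.
    by have := Bw (lift ord0 i); rewrite /B0 liftK.
  rewrite (iid_expo1_bigcap iidZ); last first.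
    move=> i; rewrite /B0; case: unlift => [j|]; first exact: mB.
    exact: measurable_itv.
  rewrite big_ord_recl /B0 unlift_none expo_tail//= mulN1r; congr (_ * _)%:E.
  by apply: eq_bigr => i _; rewrite liftK.
pose m' := Ordinal mn.
(* [Y] is the lead left after [m] subtractions. By induction its tail is again exponential of rate
   1, up to a factor: this is the lack of memory. *)
pose Y w := Z ord0 w - c * \sum_(i < n | (i < m)%N) Z' i w.
pose F := [set w | forall i : 'I_n, (m < i)%N -> B i (Z' i w)].
have mF : measurable F.
  by apply: measurable_forall => i _; exact: measurable_funPTI.
have mY : measurable_fun setT Y.
  apply: measurable_funB => //; apply: measurable_funM => //.
  by under eq_fun do rewrite -big_filter; exact: measurable_sum.
pose a := (1 + c)^-1 ^+ m *
  \prod_(i < n | (m < i)%N) fine (exponential_prob 1 (B i)).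
have ltmE (i : 'I_n) : (m <= i)%N = (i == m') || (m < i)%N.
  by rewrite leq_eqVlt eq_sym.
have XYF (x : R) (A : set R) : 0 <= x -> measurable A ->
    P (Y @^-1` `]x, +oo[ `&` (Z' m' @^-1` A `&` F)) =
    ((a * expR (- 1 * x))%:E * exponential_prob 1 A)%E.
  (* The induction hypothesis is used with [A] in slot [m'], which gives the joint law of [Y] and
     the next coordinate. *)
  move=> x0 mA; pose B1 i := if i == m' then A else B i.
  have mB1 i : measurable (B1 i) by rewrite /B1; case: ifP.
  rewrite (_ : _ `&` _ = [set w | x < Y w] `&`
    [set w | forall i : 'I_n, (m <= i)%N -> B1 i (Z' i w)]); last first.
    apply/seteqP; split => w /=; rewrite in_itv/= andbT => -[xY].
      move=> [Aw Fw]; split => // i; rewrite ltmE /B1.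
      by case: eqVneq => [->//|_]/= mi; exact: Fw.
    move=> B1w; split => //; split => [|i mi].
      by have := B1w m' (leqnn m); rewrite /B1 eqxx.
    have := B1w i (ltnW mi); rewrite /B1; case: eqVneq => // im.
    by move: mi; rewrite im ltnn.
  rewrite IH// ?(ltnW mn)//.
  rewrite (bigD1 m')//= /B1 eqxx.
  rewrite (eq_bigl (fun i : 'I_n => (m < i)%N)); last first.
    by move=> i; rewrite ltmE; case: eqVneq => [->|]; rewrite ?ltnn ?andbT.
  rewrite (eq_bigr (fun i => fine (exponential_prob 1 (B i)))); last first.
    by move=> i mi; case: eqVneq => // im; move: mi; rewrite im ltnn.
  rewrite -[exponential_prob 1 A in RHS]fineK; last first.
    exact: (fin_num_measure (expo_law (@ltr01 R)) _ mA).
  by rewrite -EFinM mulN1r /a; congr EFin; ring.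
have := @exponential_race _ _ _ P (Z' m') Y F a 1 (measurable_funPT _) mY mF ltr01 XYF c y
  false c0 y0 (iid_expo1_npos iidZ _).
rewrite (_ : [set _ | _] `&` F = [set w | y < Z ord0 w - c *
    \sum_(i < n | (i < m.+1)%N) Z' i w] `&`
  [set w | forall i : 'I_n, (m < i)%N -> B i (Z' i w)]); last first.
  have sumE w : \sum_(i < n | (i < m.+1)%N) Z' i w =
      Z' m' w + \sum_(i < n | (i < m)%N) Z' i w.
    rewrite (bigD1 m')//=; congr (_ + _); apply: eq_bigl => i.
    by rewrite ltnS [RHS]ltn_neqAle andbC.
  congr (_ `&` _); apply/seteqP; split => w /=; rewrite in_itv/= andbT sumE /Y; lra.
move=> ->; congr EFin; rewrite /a exprS mulN1r mul1r; ring.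
Qed.

Lemma sum_race (c : R) : 0 < c ->
  P [set w | c * \sum_i Z' i w < Z ord0 w] = ((1 + c)^-1 ^+ n)%:E.
Proof.
move=> c0; have := sum_race_partial c n 0 (fun=> setT) c0 (lexx 0) (leqnn n)
  (fun=> measurableT).
rewrite oppr0 expR0 mulr1 big1 ?mulr1 => [<-|i]; last by rewrite leqNgt ltn_ord.
have sumE w : \sum_(i < n | (i < n)%N) Z' i w = \sum_i Z' i w.
  by apply: eq_bigl => i; rewrite ltn_ord.
by congr (P _); apply/seteqP; split => w /=; rewrite sumE subr_gt0 => // -[].
Qed.

End races.
Arguments sum_race {d T R P n Z} iidZ {c}.

(** The minimum of [n.+1] independent Exp(1) variables has tail [expR (- n.+1%:R * y)], hence enters
    the race with rate [n.+1%:R]. *)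
Lemma min_race d (T : measurableType d) (R : realType) (P : probability T R)
    (n : nat) (Z : 'I_n.+2 -> {RV P >-> R}) (c : R) : iid_expo1 Z -> 0 < c ->
  P [set w | forall i : 'I_n.+1, c * Z ord0 w <= Z (lift ord0 i) w] =
  ((1 + n.+1%:R * c)^-1)%:E.
Proof.
move=> iidZ c0; pose Z' (i : 'I_n.+1) : {RV P >-> R} := Z (lift ord0 i).
(* The default value is itself one of the entries, so it does not change the minimum. *)
pose Y w := \big[Num.min/Z' ord0 w]_(i : 'I_n.+1) Z' i w.
have mY : measurable_fun setT Y by exact: measurable_fun_bigmin.
have XYF (y : R) (A : set R) : 0 <= y -> measurable A ->
    P (Y @^-1` `]y, +oo[ `&` (Z ord0 @^-1` A `&` setT)) =
    ((1 * expR (- n.+1%:R * y))%:E * exponential_prob 1 A)%E.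
  move=> y0 mA.
  pose B (i : 'I_n.+2) := if i == ord0 then A else `]y, +oo[%classic.
  rewrite setIT (_ : _ `&` _ = [set w | forall i, B i (Z i w)]); last first.
    apply/seteqP; split => w /=; rewrite in_itv/= andbT.
      move=> [/bigmin_gtP[_ Yw] Aw] i; rewrite /B.
      case: (unliftP ord0 i) => [j ->|->]; last by rewrite eqxx.
      by rewrite -(inj_eq val_inj)/= in_itv/= andbT; exact: Yw.
    move=> Bw; have Z'y j : y < Z' j w.
      by have := Bw (lift ord0 j); rewrite /B -(inj_eq val_inj)/= in_itv/= andbT.
    split; first by apply/bigmin_gtP; split => // i _; exact: Z'y.
    by have := Bw ord0; rewrite /B eqxx.
  rewrite (iid_expo1_bigcap iidZ); last first.
    by move=> i; rewrite /B; case: ifP => // _; exact: measurable_itv.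
  rewrite big_ord_recl /B eqxx (eq_bigr (fun=> expR (- y))) => [|i _]; last first.
    by rewrite -(inj_eq val_inj)/= expo_tail//= mulN1r.
  rewrite prodr_const card_ord -expRM_natl mul1r EFinM muleC.
  rewrite mulNr mulrN; congr (_ * _)%E; rewrite fineK//.
  exact: (fin_num_measure (expo_law (@ltr01 R)) _ mA).
have := @exponential_race _ _ _ P (Z ord0) Y setT 1 n.+1%:R (measurable_funPT _) mY
  measurableT (ltr0Sn _ _) XYF c 0 true c0 (lexx 0)
  (iid_expo1_npos iidZ _).
rewrite setIT mulr0 expR0 mul1r div1r => <-; congr (P _).
apply/seteqP; split => w /=; rewrite in_itv/= andbT add0r.
  by move=> Zw; apply/bigmin_geP; split => [|i _]; exact: Zw.
by move=> /bigmin_geP[_ Yw] i; exact: Yw.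
Qed.

(** * Probabilities of the full and of the non-empty focal elements *)

Section simplex_dsm.
Context d (T : measurableType d) (R : realType) (P : probability T R) (k : nat).
Variables (Z : 'I_k.+2 -> {RV P >-> R}) (t : R).
Hypotheses (iidZ : iid_expo1 Z) (t01 : 0 < t < 1).

Let t0 : 0 < t. Proof. by case/andP: t01. Qed.
Let q0 : 0 < 1 - t. Proof. by rewrite subr_gt0; case/andP: t01. Qed.

Let full := [set w | cond_focal t (fun i => Z i w) = simplex k.+1].
Let nonempty := [set w | cond_focal t (fun i => Z i w) !=set0].

Lemma measurable_cond_focal_full : measurable full.
Proof.
rewrite (_ : full = [set w | forall ij : 'I_k.+1 * 'I_k.+1, xpredT ij ->
    Z ord0 w * (1 - t) * (ij.2 == ij.1)%:R <= t * Z (lift ord0 ij.2) w]).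
  apply: measurable_forall => -[i j] _.
  by apply: measurable_ler_set; do ?apply: measurable_funM.
apply/seteqP; split => w; rewrite /full/= cond_focal_fullE//.
by move=> vert i j; exact: (vert (i, j) isT).
Qed.

(** Non-emptiness is an existential over points of the simplex; its explicit form, split by the sign
    of [Z ord0], leaves only finitely many inequalities. *)
Lemma measurable_cond_focal_neq0 : measurable nonempty.
Proof.
(* Despite its name, [pos] is the event where the first coordinate is not positive. *)
pose pos := [set w | Z ord0 w <= 0].
pose case1 := [set w | forall j : 'I_k.+1, xpredT j -> 0 <= t * Z (lift ord0 j) w] `&`
  [set w | Z ord0 w * (1 - t) <= t * \sum_j Z (lift ord0 j) w].
pose case2 := [set w | \sum_j Num.max (- (t * Z (lift ord0 j) w)) 0 <=
  - (Z ord0 w * (1 - t))].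
rewrite (_ : nonempty = (~` pos `&` case1) `|` (pos `&` case2)).
  have mpos : measurable pos by exact: measurable_ler_set.
  apply: measurableU; apply: measurableI => //.
  - exact: measurableC.
  - apply: measurableI.
      apply: measurable_forall => j _.
      by apply: (@measurable_ler_set _ T R (cst 0)) => //; exact: measurable_funM.
    apply: measurable_ler_set; first exact: measurable_funM.
    by apply: measurable_funM => //; exact: measurable_sum.
  - apply: measurable_ler_set.
      apply: measurable_sum => j; apply: (@measurable_maxr _ T R _ _ (cst 0)) => //.
      by apply: measurable_funN; exact: measurable_funM.
    by apply: measurable_funN; exact: measurable_funM.
apply/seteqP; split => w; rewrite /nonempty /= cond_focal_neq0E// /pos/= ltNge.
  case: (boolP (Z ord0 w <= 0)) => /= [Zle c2|Zgt [zj c1]]; first by right.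
  by left; split => //; split => // j _; exact: zj.
case: (boolP (Z ord0 w <= 0)) => /= [Zle [[]//|[_]//]|Zgt [[_ [zj c1]]|[]//]].
by split => // j; exact: zj.
Qed.

Lemma prob_cond_focal_full : P full = (t / (1 + k%:R * (1 - t)))%:E.
Proof.
have c0 : 0 < (1 - t) / t by rewrite divr_gt0.
transitivity (P [set w | forall i : 'I_k.+1, (1 - t) / t * Z ord0 w <= Z (lift ord0 i) w]).
  apply: (iid_expo1_eq iidZ) => [||w Zpos].
  - exact: measurable_cond_focal_full.
  - rewrite (_ : [set _ | _] = [set w | forall i : 'I_k.+1, xpredT i ->
        (1 - t) / t * Z ord0 w <= Z (lift ord0 i) w]); last first.
      by apply/seteqP; split => w le i *; exact: le.
    apply: measurable_forall => i _; apply: measurable_ler_set => //.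
    exact: measurable_funM.
  have E (j : 'I_k.+1) : ((1 - t) / t * Z ord0 w <= Z (lift ord0 j) w) =
      (Z ord0 w * (1 - t) <= t * Z (lift ord0 j) w).
    by rewrite mulrAC ler_pdivrMr// mulrC [leRHS]mulrC.
  rewrite /full/= cond_focal_fullE//; split => [vert j|le i j].
    by rewrite E; have := vert j j; rewrite eqxx mulr1.
  case: eqVneq => _; first by rewrite mulr1 -E.
  by rewrite mulr0 mulr_ge0// ltW.
(* The [k.+1] competitors give the denominator [t + k.+1%:R * (1 - t)], which equals
   [1 + k%:R * (1 - t)]. *)
rewrite min_race//; congr EFin; rewrite -[k.+1]addn1 natrD.
have ? : t != 0 by rewrite gt_eqF.
rewrite -[RHS]invrK invf_div; by congr (_^-1); field.
Qed.

Lemma prob_cond_focal_neq0 : P nonempty = (1 - (1 - t) ^+ k.+1)%:E.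
Proof.
have c0 : 0 < t / (1 - t) by rewrite divr_gt0.
(* Rewrites [1 - t] as the probability of winning one stage of the race with [c = t / (1 - t)]. *)
have <- : (1 + t / (1 - t))^-1 = 1 - t.
  have ? : 1 - t != 0 by rewrite gt_eqF.
  by rewrite -[RHS]invrK; congr (_^-1); field.
rewrite -[nonempty]setCK probability_setC; last first.
  by apply: measurableC; exact: measurable_cond_focal_neq0.
rewrite EFinB; congr (_ - _)%E; rewrite -(sum_race iidZ c0).
apply: (iid_expo1_eq iidZ) => [||w Zpos].
- by apply: measurableC; exact: measurable_cond_focal_neq0.
- rewrite (_ : [set _ | _] = ~` [set w | Z ord0 w <= t / (1 - t) *
      \sum_i Z (lift ord0 i) w]).
    apply/measurableC/measurable_ler_set => //.
    by apply: measurable_funM => //; exact: measurable_sum.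
  by apply/seteqP; split => w /=; rewrite ltNge => /negP.
rewrite /nonempty/= cond_focal_neq0E// Zpos mulrAC ltr_pdivrMr// mulrC [ltRHS]mulrC.
split => [notle|lt [_]]; last by rewrite leNgt mulrC lt.
rewrite ltNge; apply/negP => le; apply: notle; split => [j|].
  by rewrite mulr_ge0// ltW.
by rewrite mulrC.
Qed.

Lemma cond_focal_full_sub : full `<=` nonempty.
Proof.
move=> w; rewrite /full /nonempty/= => ->.
exists (fun j => (j == ord0)%:R); exact: simplex_vertex.
Qed.

End simplex_dsm.

(* K = k.+2 >= 2 categories; S_{K-2} = simplex k.+1. *)
Theorem theorem3 (R : realType) (k : nat) (d : measure_display)
  (T : measurableType d) (P : probability T R)
  (Z : 'I_k.+2 -> {RV P >-> R}) (th1 : R) :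
  iid_expo1 Z -> 0 < th1 < 1 ->
  cond_prob P
    [set w | cond_focal th1 (fun i => Z i w) = simplex k.+1]
    [set w | cond_focal th1 (fun i => Z i w) !=set0]
  = (1 + k%:R * (1 - th1))^-1 *
    (1 + \sum_(1 <= i < k.+1) (1 - th1) ^+ i)^-1.
Proof.
move=> iidZ th01; have /andP[th0 th1_lt1] := th01.
rewrite /cond_prob setIidl; last exact: cond_focal_full_sub.
rewrite prob_cond_focal_full// prob_cond_focal_neq0//=.
have -> : 1 + \sum_(1 <= i < k.+1) (1 - th1) ^+ i = \sum_(i < k.+1) (1 - th1) ^+ i.
  by rewrite -(big_mkord xpredT (fun i => (1 - th1) ^+ i)) [RHS]big_ltn// expr0.
(* Geometric sum; the factor [th1] cancels the numerator of the probability of the full simplex. *)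
have -> : 1 - (1 - th1) ^+ k.+1 = th1 * \sum_(i < k.+1) (1 - th1) ^+ i.
  by rewrite -opprB subrX1 -mulNr; congr (_ * _); ring.
by rewrite invfM mulrA; congr (_ * _); rewrite mulrAC divff ?gt_eqF// mul1r.
Qed.
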